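(* Let $1\le p\le n-1$ with $\gcd(p,n)=1$, and let $p'$ be the integer satisfying $1\le p'<n$ and $pp'\equiv1\pmod n$. Let $c=s_1s_2\cdots s_{n-1}=(1\,2\cdots n)\in\mathfrak{S}_n$. Let $g\in\mathfrak{S}_n$ be the permutation with $g(i)\equiv ip'\pmod n$ for all $i\in\{1,\ldots,n\}$, and let $\mathbf{g}=\mathbf{B}(g)$. Then $$\mathbf{g}\,\mathbf{B}(c)^p\,\mathbf{g}^{-1}\,\mathbf{B}(c)^{-1}=\mathbf{B}(x_p)\,\mathbf{B}(x_p^{-1}),$$ where $x_p=v_{k_1}v_{k_2}\cdots v_{k_{p-1}}$ with $k_i=\lfloor in/p\rfloor$ and $v_k=s_ks_{k-1}\cdots s_1$. In particular, $\mathbf{g}$ is a realizable positive dual $(c,p)$-conjugator.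
   Context: $\mathfrak{S}_n$ is the symmetric group on $\{1,\ldots,n\}$ with simple reflections $s_i=(i\;i+1)$; its reflections are the transpositions, and its rank is $r=n-1$. $\mathbf{B}_n$ is the $n$-strand braid group with Artin generators $\mathbf{s}_1,\ldots,\mathbf{s}_{n-1}$; $\mathbf{s}_i\mapsto s_i$ defines a surjection $\mathbf{B}_n\to\mathfrak{S}_n$, and a lift of $w\in\mathfrak{S}_n$ is a preimage of $w$. If $(s_{i_1},\ldots,s_{i_k})$ is a reduced word for $w$, then $\mathbf{B}(w)=\mathbf{s}_{i_1}\cdots\mathbf{s}_{i_k}$. For $i<j$, the $c$-dual lift of the transposition $(i\,j)$ is $\mathbf{t}_{(ij)}=\mathbf{s}_i\cdots\mathbf{s}_{j-2}\mathbf{s}_{j-1}\mathbf{s}_{j-2}^{-1}\cdots\mathbf{s}_i^{-1}$, and $\mathbb{P}_c((i\,j))=\mathbf{t}_{(ij)}^2$. Let $\mathbf{g}\in\mathbf{B}_n$ be a lift of an element $g$ satisfying $gc^pg^{-1}=c$, and let $\mathbb{c}_{p,\mathbf{g}}=\mathbf{g}\mathbf{B}(c)^p\mathbf{g}^{-1}\mathbf{B}(c)^{-1}$. Then $\mathbf{g}$ is called a positive dual $(c,p)$-conjugator if $\mathbb{c}_{p,\mathbf{g}}=\mathbb{P}_c(t_1)\cdots\mathbb{P}_c(t_M)$ for some reflections $t_1,\ldots,t_M$, where $M=r(p-1)/2$; it is realizable if moreover there exists $x\in\mathfrak{S}_n$ with $\mathbb{c}_{p,\mathbf{g}}=\mathbf{B}(x)\mathbf{B}(x^{-1})$.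 *)

(* Defs.v *)
From HB Require Import structures.
From mathcomp Require Import all_boot all_fingroup.
From mathcomp Require Import boolp zify.

Set Implicit Arguments.
Unset Strict Implicit.
Unset Printing Implicit Defensive.

Local Open Scope group_scope.

(* Conventions.  The set {1, ..., n} is represented by 'I_n and the index set *)
(* {1, ..., n-1} of the simple generators by 'I_n.-1, both shifted by one:    *)
(* the ordinal i stands for the integer i.+1.                                 *)

(* Permutations are composed from right to left, as functions, so that        *)
(* s_1 s_2 ... s_(n-1) is the cycle (1 2 ... n) (see coxE below).  This is    *)
(* the opposite of the product of 'S_n in MathComp; powers and inverses are   *)
(* the same for both products.                                                *)
Definition pcomp n (s t : 'S_n) : 'S_n := t * s.

Notation "s \oS t" := (pcomp s t) (at level 50, left associativity).

Lemma pcompE n (s t : 'S_n) (i : 'I_n) : (s \oS t) i = s (t i).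
Proof. exact: permM. Qed.

Lemma pcompA n : associative (@pcomp n).
Proof. by move=> s t u; rewrite /pcomp mulgA. Qed.

Lemma pcomp1g n : left_id 1 (@pcomp n).
Proof. exact: mulg1. Qed.

Lemma pcompg1 n : right_id 1 (@pcomp n).
Proof. exact: mul1g. Qed.

HB.instance Definition _ n :=
  Monoid.isLaw.Build 'S_n 1 (@pcomp n) (@pcompA n) (@pcomp1g n) (@pcompg1 n).

Lemma lo_proof n (i : 'I_n.-1) : i < n.
Proof. exact: leq_trans (ltn_ord i) (leq_pred n). Qed.

Lemma hi_proof n (i : 'I_n.-1) : i.+1 < n.
Proof. by case: n i => [[]|n i] //=; rewrite ltnS. Qed.

Definition simple_refl n (i : 'I_n.-1) : 'S_n :=
  tperm (Ordinal (lo_proof i)) (Ordinal (hi_proof i)).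

Definition word_perm n (r : seq 'I_n.-1) : 'S_n :=
  \big[@pcomp n/1]_(i <- r) simple_refl i.

(* Increasing sequence of the generator indices i with a <= i < b. *)
Definition gens n (a b : nat) : seq 'I_n.-1 :=
  [seq i : 'I_n.-1 <- enum 'I_n.-1 | a <= i < b].

Definition cox n : 'S_n := word_perm (enum 'I_n.-1).

Lemma word_perm_cat n (r s : seq 'I_n.-1) :
  word_perm (r ++ s) = word_perm r \oS word_perm s.
Proof. exact: big_cat. Qed.

Lemma simple_reflE n (k : 'I_n.-1) (i : 'I_n) :
  simple_refl k i = (if i == k :> nat then k.+1
                     else if i == k.+1 :> nat then k : nat else i) :> nat.
Proof.
rewrite /simple_refl; case: tpermP => [->|->|] /=.
- by rewrite eqxx.
- by rewrite eqn_leq ltnn eqxx.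
by move=> /eqP; rewrite -val_eqE /= => /negPf-> /eqP; rewrite -val_eqE => /negPf->.
Qed.

Lemma word_perm_take n m (i : 'I_n) : m < n ->
  word_perm (take m (enum 'I_n.-1)) i
    = (if i < m then i.+1 else if i == m :> nat then 0%N else i) :> nat.
Proof.
elim: m i => [|m IHm] i lt_m.
  by rewrite take0 /word_perm big_nil perm1; case: eqP.
have lt_m' : m < n.-1 by case: n lt_m {i IHm}.
pose k := Ordinal lt_m'.
rewrite (take_nth k) ?size_enum_ord // -cats1 word_perm_cat pcompE.
rewrite /word_perm big_seq1 -/(word_perm _) IHm ?(ltnW lt_m) //.
rewrite simple_reflE nth_enum_ord //=.
move: (nat_of_ord i) => {}i.
by case: (i =P m) => ?; case: (i =P m.+1) => ?;
   repeat case: ifP => ?; lia.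
Qed.

Lemma coxE n (i : 'I_n) : cox n i = i.+1 %% n :> nat.
Proof.
case: n i => [[] //|n] i.
rewrite /cox -[enum _]take_size size_enum_ord word_perm_take //=.
case: ltngtP => [lt_i|gt_i|->]; first by rewrite modn_small.
  by move: (ltn_ord i); rewrite ltnS leqNgt gt_i.
by rewrite modnn.
Qed.

(* s_k s_(k-1) ... s_1 *)
Definition vperm n (k : nat) : 'S_n := word_perm (rev (gens n 0 k)).

(* Braid words: (i, false) is the Artin generator s_i, (i, true) its inverse. *)
Definition braid_word n := seq ('I_n.-1 * bool).

Definition pos_word n (r : seq 'I_n.-1) : braid_word n :=
  [seq (i, false) | i <- r].

Definition inv_word n (u : braid_word n) : braid_word n :=
  rev [seq (l.1, ~~ l.2) | l <- u].

Inductive braid_equiv n : braid_word n -> braid_word n -> Prop :=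
| BraidRefl u : braid_equiv u u
| BraidSym u v : braid_equiv u v -> braid_equiv v u
| BraidTrans u v w : braid_equiv u v -> braid_equiv v w -> braid_equiv u w
| BraidCat u u' v v' :
    braid_equiv u u' -> braid_equiv v v' -> braid_equiv (u ++ v) (u' ++ v')
| BraidCancel (i : 'I_n.-1) (b : bool) :
    braid_equiv [:: (i, b); (i, ~~ b)] [::]
| BraidBraid (i j : 'I_n.-1) : j = i.+1 :> nat ->
    braid_equiv (pos_word [:: i; j; i]) (pos_word [:: j; i; j])
| BraidComm (i j : 'I_n.-1) : i.+1 < j ->
    braid_equiv (pos_word [:: i; j]) (pos_word [:: j; i]).

Definition braid_equivb n : rel (braid_word n) :=
  fun u v => `[< braid_equiv u v >].

Lemma braid_equivb_refl n : reflexive (@braid_equivb n).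
Proof. by move=> u; apply/asboolP; exact: BraidRefl. Qed.

Lemma braid_equivb_sym n : symmetric (@braid_equivb n).
Proof. by move=> u v; apply/asboolP/asboolP; exact: BraidSym. Qed.

Lemma braid_equivb_trans n : transitive (@braid_equivb n).
Proof.
move=> v u w /asboolP uv /asboolP vw.
by apply/asboolP; exact: BraidTrans uv vw.
Qed.

Canonical braid_equiv_rel n :=
  EquivRel (@braid_equivb n) (@braid_equivb_refl n) (@braid_equivb_sym n)
    (@braid_equivb_trans n).

Definition braid n : Type := {eq_quot @braid_equiv_rel n}%qT.

HB.instance Definition _ n := Choice.on (braid n).

Definition to_braid n (u : braid_word n) : braid n :=
  (\pi_({eq_quot @braid_equiv_rel n}) u)%qT.

Lemma to_braidP n (u v : braid_word n) :
  reflect (braid_equiv u v) (to_braid u == to_braid v).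
Proof. by rewrite /to_braid piE; apply: asboolP. Qed.

Definition braid_repr n (x : braid n) : braid_word n :=
  generic_quotient.repr (x : {eq_quot @braid_equiv_rel n}%qT).

Lemma braid_reprK n : cancel (@braid_repr n) (@to_braid n).
Proof. exact: reprK. Qed.

Lemma to_braidK n (u : braid_word n) : braid_equiv (braid_repr (to_braid u)) u.
Proof. by apply/to_braidP; rewrite braid_reprK. Qed.

Definition braid_one n : braid n := to_braid [::].

Definition braid_mul n (x y : braid n) : braid n :=
  to_braid (braid_repr x ++ braid_repr y).

Definition braid_inv n (x : braid n) : braid n :=
  to_braid (inv_word (braid_repr x)).

Lemma braid_mulE n (u v : braid_word n) :
  braid_mul (to_braid u) (to_braid v) = to_braid (u ++ v).
Proof. by apply/eqP/to_braidP; apply: BraidCat; apply: to_braidK. Qed.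

Lemma inv_word_cat n (u v : braid_word n) :
  inv_word (u ++ v) = inv_word v ++ inv_word u.
Proof. by rewrite /inv_word map_cat rev_cat. Qed.

Lemma inv_wordK n : involutive (@inv_word n).
Proof.
move=> u; rewrite /inv_word map_rev revK -map_comp -[RHS]map_id.
by apply: eq_map => -[i b] /=; rewrite negbK.
Qed.

Lemma inv_word_mulV n (u : braid_word n) : braid_equiv (u ++ inv_word u) [::].
Proof.
elim: u => [|[i b] u IHu]; first exact: BraidRefl.
rewrite -cat1s inv_word_cat -catA (catA u).
apply: BraidTrans (BraidCancel i b); rewrite -[X in braid_equiv _ X]cat1s.
apply: BraidCat (BraidRefl _) _.
exact: (BraidCat IHu (BraidRefl _)).
Qed.

Lemma braid_mulA n : associative (@braid_mul n).
Proof.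
move=> x y z; rewrite -(braid_reprK x) -(braid_reprK y) -(braid_reprK z).
by rewrite !braid_mulE catA.
Qed.

Lemma braid_mul1g n : left_id (@braid_one n) (@braid_mul n).
Proof. by move=> x; rewrite -(braid_reprK x) braid_mulE. Qed.

Lemma braid_mulg1 n : right_id (@braid_one n) (@braid_mul n).
Proof. by move=> x; rewrite -(braid_reprK x) braid_mulE cats0. Qed.

Lemma braid_mulgV n :
  right_inverse (@braid_one n) (@braid_inv n) (@braid_mul n).
Proof.
move=> x; rewrite -{1}(braid_reprK x) braid_mulE.
by apply/eqP/to_braidP; exact: inv_word_mulV.
Qed.

Lemma braid_mulVg n :
  left_inverse (@braid_one n) (@braid_inv n) (@braid_mul n).
Proof.
move=> x; rewrite -{2}(braid_reprK x) braid_mulE; apply/eqP/to_braidP.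
by have := inv_word_mulV (inv_word (braid_repr x)); rewrite inv_wordK.
Qed.

HB.instance Definition _ n :=
  isGroup.Build (braid n) (@braid_mulA n) (@braid_mul1g n) (@braid_mulg1 n)
    (@braid_mulVg n) (@braid_mulgV n).

Definition artin n (i : 'I_n.-1) : braid n := to_braid [:: (i, false)].

Lemma to_braid_pos n (r : seq 'I_n.-1) :
  to_braid (pos_word r) = \prod_(i <- r) artin i.
Proof.
elim: r => [|i r IHr]; first by rewrite big_nil.
by rewrite big_cons -IHr; apply/esym/(braid_mulE [:: (i, false)]).
Qed.

(* The surjection from the braid group onto 'S_n.  Both letters (i, false)    *)
(* and (i, true) are sent to s_i, which is an involution.                     *)
Definition braid_perm n (x : braid n) : 'S_n :=
  word_perm (unzip1 (braid_repr x)).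

Lemma simple_reflK n (i : 'I_n.-1) : simple_refl i \oS simple_refl i = 1.
Proof. exact: tperm2. Qed.

Lemma word_perm_equiv n (u v : braid_word n) :
  braid_equiv u v -> word_perm (unzip1 u) = word_perm (unzip1 v).
Proof.
elim=> {u v} //= [u v w _ -> _ -> //|u u' v v' _ eu _ ev|i b|i j ij|i j ij].
- by rewrite /unzip1 !map_cat !word_perm_cat eu ev.
- by rewrite /word_perm !big_cons !big_nil pcompg1 simple_reflK.
- rewrite /word_perm !big_cons !big_nil !pcompg1 /pcomp /simple_refl.
  have -> : Ordinal (lo_proof j) = Ordinal (hi_proof i) by apply/val_inj.
  set a := Ordinal (lo_proof i); set b := Ordinal (hi_proof i).
  set c := Ordinal (hi_proof j).
  have ab : a != b by rewrite -val_eqE /= neq_ltn ltnSn.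
  have bc : b != c by rewrite -val_eqE /= ij neq_ltn ltnSn.
  have ac : a != c by rewrite -val_eqE /= ij neq_ltn ltnS leqnSn.
  have eL : tperm a b * tperm b c * tperm a b = tperm a c.
    rewrite -{1}(tpermV a b) -mulgA -/(tperm b c ^ tperm a b) tpermJ.
    by rewrite tpermR tpermD // eq_sym.
  have eR : tperm b c * tperm a b * tperm b c = tperm a c.
    rewrite -{1}(tpermV b c) -mulgA -/(tperm a b ^ tperm b c) tpermJ.
    by rewrite tpermL tpermD // eq_sym.
  by rewrite eL eR.
- rewrite /word_perm !big_cons !big_nil !pcompg1 /pcomp /simple_refl.
  set a := Ordinal (lo_proof i); set b := Ordinal (hi_proof i).
  set c := Ordinal (lo_proof j); set d := Ordinal (hi_proof j).
  apply: (mulgI (tperm a b)); rewrite !mulgA tperm2 mul1g.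
  rewrite -{1}(tpermV a b) -mulgA -/(tperm c d ^ tperm a b) tpermJ.
  by rewrite !tpermD // -val_eqE /= neq_ltn ?ltnS ?(ltnW ij) ?ij
    ?(ltnW (ltnW ij)) ?leqW // ltnW.
Qed.

Lemma to_braid_perm n (u : braid_word n) :
  braid_perm (to_braid u) = word_perm (unzip1 u).
Proof. exact/word_perm_equiv/to_braidK. Qed.

Lemma braid_permM n (x y : braid n) :
  braid_perm (x * y) = braid_perm x \oS braid_perm y.
Proof.
rewrite [braid_perm _](to_braid_perm (braid_repr x ++ braid_repr y)).
by rewrite /unzip1 map_cat word_perm_cat.
Qed.

Lemma braid_perm_artin n (i : 'I_n.-1) :
  braid_perm (artin i) = simple_refl i.
Proof. by rewrite to_braid_perm /word_perm big_seq1. Qed.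

Lemma index_lt n (i j : 'I_n) : i < j -> i < n.-1.
Proof. by case: n i j => [[] //|n] i j ij; apply: leq_trans ij (ltn_ord j). Qed.

Lemma word_perm_tperm n (i j : 'I_n) :
  i < j -> exists r, word_perm r = tperm i j.
Proof.
move: {2}(j - i.+1)%N (erefl (j - i.+1)%N) => d.
elim: d i => [|d IHd] i Ed ij; pose k := Ordinal (index_lt ij).
  exists [:: k]; rewrite /word_perm big_seq1 /simple_refl.
  congr tperm; apply/val_inj => //=.
  by apply/eqP; rewrite eqn_leq ij -subn_eq0 Ed.
have ij2 : i.+1 < j by rewrite -subn_gt0 Ed.
have [|//|r Er] := IHd (Ordinal (hi_proof k)); first by rewrite /= subnS Ed.
exists ([:: k] ++ r ++ [:: k]).
rewrite !word_perm_cat Er /word_perm big_seq1 /pcomp /simple_refl.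
set a := Ordinal (lo_proof k); have -> : i = a by apply/val_inj.
set b := Ordinal (hi_proof k).
rewrite -{1}(tpermV a b) -mulgA -/(tperm b j ^ tperm a b) tpermJ tpermR.
by rewrite tpermD // -val_eqE /= neq_ltn ?ij ?ij2.
Qed.

Lemma word_permP n (w : 'S_n) : exists r, word_perm r == w.
Proof.
have [ts -> _] := prod_tpermP w.
elim: ts => [|[i j] ts [r /eqP Er]].
  by exists [::]; rewrite /word_perm !big_nil.
rewrite big_cons -Er /=.
have [s Es] : exists s, word_perm s = tperm i j.
  case: (ltngtP i j) => [ij|ji|/val_inj ->]; first exact: word_perm_tperm.
    by rewrite tpermC; apply: word_perm_tperm.
  by exists [::]; rewrite /word_perm big_nil tperm1.
by exists (r ++ s); rewrite word_perm_cat Es.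
Qed.

Lemma word_perm_sizeP n (w : 'S_n) :
  exists m, [exists t : m.-tuple 'I_n.-1, word_perm t == w].
Proof.
have [r Er] := word_permP w; exists (size r).
by apply/existsP; exists (in_tuple r).
Qed.

Definition perm_length n (w : 'S_n) : nat := ex_minn (word_perm_sizeP w).

Definition reduced_word_of n (w : 'S_n) (r : seq 'I_n.-1) : bool :=
  (word_perm r == w) && (size r == perm_length w).

Lemma reduced_word_ofP n (w : 'S_n) (r : seq 'I_n.-1) :
  reflect (word_perm r = w /\
           forall s : seq 'I_n.-1, word_perm s = w -> size r <= size s)
    (reduced_word_of w r).
Proof.
have le_m s : word_perm s = w -> perm_length w <= size s.
  rewrite /perm_length; case: ex_minnP => m _ min_m Es.
  by apply/min_m/existsP; exists (in_tuple s); apply/eqP.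
apply: (iffP andP) => [[/eqP Er /eqP ->]|[Er min_r]].
  by split=> // s; apply: le_m.
have [t [Et size_t]] : exists t : seq 'I_n.-1,
    word_perm t = w /\ size t = perm_length w.
  rewrite /perm_length; case: ex_minnP => m /existsP[t /eqP Et] _.
  by exists t; rewrite size_tuple.
by rewrite Er eqxx eqn_leq le_m // -size_t min_r.
Qed.

Lemma reduced_word_exists n (w : 'S_n) : exists r, reduced_word_of w r.
Proof.
rewrite /reduced_word_of /perm_length.
case: ex_minnP => m /existsP[t Et] _.
by exists t; rewrite Et size_tuple eqxx.
Qed.

(* The positive lift B(w) = s_(i_1) ... s_(i_k), for a chosen reduced word of *)
(* w; by Matsumoto's theorem all reduced words of w give the same braid.      *)
Definition Blift n (w : 'S_n) : braid n :=
  \prod_(i <- xchoose (reduced_word_exists w)) artin i.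

Lemma Blift_perm n (w : 'S_n) : braid_perm (Blift w) = w.
Proof.
rewrite /Blift -to_braid_pos to_braid_perm /unzip1 -map_comp map_id.
by case/andP: (xchooseP (reduced_word_exists w)) => /eqP.
Qed.

(* s_i ... s_(j-2) s_(j-1) s_(j-2)^-1 ... s_i^-1, for i < j. *)
Definition dual_lift n (i j : 'I_n) : braid n :=
  \prod_(k <- gens n i j) artin k * (\prod_(k <- gens n i j.-1) artin k)^-1.

Definition Pdual n (i j : 'I_n) : braid n := dual_lift i j ^+ 2.

Definition conj_braid n (p : nat) (b : braid n) : braid n :=
  b * Blift (cox n) ^+ p * b^-1 * (Blift (cox n))^-1.

(* The reflection (i j), with i < j, is represented by the pair (i, j).  The  *)
(* condition on the size is M = r (p - 1) / 2, with r = n - 1.                *)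
Definition positive_dual_conjugator n (p : nat) (b : braid n) : Prop :=
  braid_perm b \oS cox n ^+ p \oS (braid_perm b)^-1 = cox n /\
  exists ts : seq ('I_n * 'I_n),
    [/\ all (fun t : 'I_n * 'I_n => t.1 < t.2) ts,
        (size ts * 2 = n.-1 * p.-1)%N
      & conj_braid p b = \prod_(t <- ts) Pdual t.1 t.2].

Definition realizable_positive_dual_conjugator n (p : nat) (b : braid n) :
    Prop :=
  positive_dual_conjugator p b /\
  exists x : 'S_n, conj_braid p b = Blift x * Blift x^-1.

(* v_(k_1) ... v_(k_(p-1)), with k_i = floor (i n / p). *)
Definition xperm n (p : nat) : 'S_n :=
  \big[@pcomp n/1]_(1 <= i < p) vperm n ((i * n)%N %/ p).

(* Main.v *)
Require Import Defs.
From mathcomp Require Import all_boot all_fingroup.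
From mathcomp Require Import zify.

(* Let D = B(c), and let L_k = s_k ... s_1 s_1 ... s_k be the Jucys-Murphy    *)
(* braids, which commute pairwise.  For every permutation w,                  *)
(*     B(w) D = L_(w(1) - 1) B(w c),                                          *)
(* by induction on the length of w.  Iterating from w = g gives               *)
(*     B(g) D^p = L_(g(1) - 1) ... L_(g(p) - 1) B(g c^p).                     *)
(* Here g c^p = c g, and B(c g) = D B(g) because g fixes n.  Moreover         *)
(* {g(1), ..., g(p)} = {k_i + 1 : 0 <= i < p}.  Hence the conjugator is the   *)
(* product of the L_(k_i).  On the other side, as the k_i increase, B(x_p) is *)
(* the product of the B(v_(k_i)), and B(v_k) B(v_k^-1) = L_k commutes with    *)
(* the factors of smaller index, so B(x_p) B(x_p^-1) is the same product.     *)
(* Finally L_k is the product of the squares of the k dual lifts of           *)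
(* (i k+1), i <= k.                                                           *)

(** Both sides are products of Jucys-Murphy braids, so the identity reduces to comparing two lists
    of indices. The left side unfolds by [Blift_mul_cox_exp], which iterates [Blift_mul_cox];
    [Blift_coxM] lets the rest cancel, and [jucys_murphy_comm] permits reordering. The right side is
    [Blift_vprod]. All of them rest on additivity of length: by [reduced_wordE] the length counts
    inversions, and by [matsumoto] the braid [Blift w] is independent of the reduced word, so
    [Blift] is multiplicative whenever lengths add. For the dual factorization, [jucys_murphy_dual]
    supplies the factors and [sum_div_mul] counts them. *)

Set Implicit Arguments.
Unset Strict Implicit.
Unset Printing Implicit Defensive.

Local Open Scope group_scope.

(** * Inversions and Coxeter length *)

Section Length.

Variable n : nat.
Implicit Types (w : 'S_n) (i j : 'I_n.-1) (r : seq 'I_n.-1).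

Definition lo i : 'I_n := Ordinal (lo_proof i).
Definition hi i : 'I_n := Ordinal (hi_proof i).

(** The value [lo i] stands left of [hi i] in the one-line notation of [w]; equivalently, left
    multiplication by s_i lengthens [w]. *)
Definition ascent w i : bool := w^-1 (lo i) < w^-1 (hi i).

Definition inversions w : {set 'I_n * 'I_n} :=
  [set ab : 'I_n * 'I_n | (ab.1 < ab.2) && (w ab.2 < w ab.1)].

Lemma simple_reflVE w i (a : 'I_n) :
  (simple_refl i \oS w)^-1 a = w^-1 (simple_refl i a).
Proof. by rewrite /Defs.pcomp invMg permM tpermV. Qed.

Lemma simple_refl_lo i : simple_refl i (lo i) = hi i.
Proof. exact: tpermL. Qed.

Lemma simple_refl_hi i : simple_refl i (hi i) = lo i.
Proof. exact: tpermR. Qed.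

Lemma simple_reflKl i w : simple_refl i \oS (simple_refl i \oS w) = w.
Proof. by rewrite pcompA simple_reflK pcomp1g. Qed.

Lemma ascent_simple_refl w i : ascent (simple_refl i \oS w) i = ~~ ascent w i.
Proof.
rewrite /ascent !simple_reflVE simple_refl_lo simple_refl_hi -leqNgt.
have : w^-1 (hi i) != w^-1 (lo i).
  by rewrite (inj_eq perm_inj) -val_eqE /= gtn_eqF.
by rewrite [in RHS]leq_eqVlt -val_eqE /= => /negPf->.
Qed.

(** Exchanging two adjacent values alters the relative order only of the two positions that hold
    them. *)
Lemma inversions_simple_refl w i : ascent w i ->
  inversions (simple_refl i \oS w)
    = (w^-1 (lo i), w^-1 (hi i)) |: inversions w.
Proof.
move=> asc; apply/setP=> -[a b]; rewrite !inE !pcompE -pair_eqE /=.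
rewrite -!(canF_eq (permK w)) -!val_eqE /= !simple_reflE.
case: (ltnP a b) => [lt_ab|le_ba] /=; last first.
  rewrite orbF; apply/esym/negP=> /andP[/eqP wa /eqP wb].
  move: asc; rewrite /ascent.
  have -> : lo i = w a by apply/val_inj.
  have -> : hi i = w b by apply/val_inj.
  by rewrite !permK ltnNge le_ba.
have ne : w a != w b by rewrite (inj_eq perm_inj) -val_eqE /= ltn_eqF.
have nlo : ~ (w a = i.+1 :> nat /\ w b = i :> nat).
  move=> [wa wb]; move: asc; rewrite /ascent.
  have -> : lo i = w b by apply/val_inj.
  have -> : hi i = w a by apply/val_inj.
  by rewrite !permK ltnNge ltnW.
move: ne nlo; rewrite -val_eqE /=; move: (nat_of_ord (w a)) (nat_of_ord (w b)).
move=> x y.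
by case: (x =P i); case: (x =P i.+1); case: (y =P i); case: (y =P i.+1); lia.
Qed.

Lemma card_inversions_ascent w i : ascent w i ->
  #|inversions (simple_refl i \oS w)| = #|inversions w|.+1.
Proof.
move=> asc; rewrite inversions_simple_refl // cardsU1 inE /= !permKV /=.
by rewrite [(i.+1 < i)%N]ltnNge leqnSn andbF.
Qed.

Lemma card_inversions_le w i :
  #|inversions (simple_refl i \oS w)| <= #|inversions w|.+1.
Proof.
have [/card_inversions_ascent -> //|] := boolP (ascent w i).
rewrite -ascent_simple_refl => /card_inversions_ascent.
by rewrite simple_reflKl => ->; rewrite leqW.
Qed.

Lemma card_inversions_word r : #|inversions (word_perm r)| <= size r.
Proof.
elim: r => [|i r IHr].
  rewrite /word_perm big_nil leqn0 cards_eq0; apply/eqP/setP=> -[a b].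
  by rewrite !inE !perm1 /=; case: ltnP => // /ltnW; rewrite leqNgt => /negPf.
rewrite /word_perm big_cons -/(word_perm r).
exact: leq_trans (card_inversions_le _ _) _.
Qed.

(** Increasing on neighbours, [w^-1] is increasing everywhere, and the identity is the only
    increasing permutation. *)
Lemma all_ascents w : (forall i, ascent w i) -> w = 1.
Proof.
move=> asc; suff: w^-1 = 1 by move/(canRL invgK); rewrite invg1.
have mono (a b : 'I_n) : a < b -> w^-1 a < w^-1 b.
  move: {2}(b - a.+1)%N (erefl (b - a.+1)%N) => d.
  elim: d a => [|d IHd] a Ed ab.
    have := asc (Ordinal (index_lt ab)); rewrite /ascent.
    have -> : lo (Ordinal (index_lt ab)) = a by apply/val_inj.
    by have -> : hi (Ordinal (index_lt ab)) = b by apply/val_inj => /=; lia.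
  have := asc (Ordinal (index_lt ab)); rewrite /ascent.
  have -> : lo (Ordinal (index_lt ab)) = a by apply/val_inj.
  by move/ltn_trans; apply; apply: IHd => /=; lia.
have geq_id (a : 'I_n) : a <= w^-1 a.
  case: a => m; elim: m => [|m IHm] lt_m //.
  by apply: leq_ltn_trans (IHm (ltnW lt_m)) _; apply: mono => /=.
have leq_id (a : 'I_n) : w^-1 a <= a.
  move: {2}(n - a)%N (erefl (n - a)%N) => d.
  elim: d a => [|d IHd] a Ed; first by have := ltn_ord a; lia.
  have [lt_a|ge_a] := ltnP a.+1 n; last first.
    by have := ltn_ord (w^-1 a); lia.
  have := mono a (Ordinal lt_a) (ltnSn a).
  by have /= := IHd (Ordinal lt_a); move=> H /leq_trans/(_ (H _)); apply; lia.
apply/permP=> a; rewrite perm1; apply/val_inj/eqP.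
by rewrite eqn_leq geq_id leq_id.
Qed.

(** Induction on length: if [w] is not 1, some i is not an ascent, and [w] is s_i times a shorter
    element of which i is an ascent. *)
Lemma perm_ascent_ind (P : 'S_n -> Prop) :
  P 1 -> (forall w i, ascent w i -> P w -> P (simple_refl i \oS w)) ->
  forall w, P w.
Proof.
move=> P1 PS w; move: {2}#|_| (erefl #|inversions w|) => m.
elim: m w => [|m IHm] w Em.
all: have [/forallP/all_ascents -> //|] := boolP [forall i, ascent w i].
all: rewrite negb_forall => /existsP[i]; rewrite -ascent_simple_refl => asc.
all: have := card_inversions_ascent asc; rewrite simple_reflKl Em // => -[Em'].
by rewrite -(simple_reflKl i w); apply: PS asc (IHm _ (esym Em')).
Qed.

Lemma word_of_inversions w :
  exists2 r, word_perm r = w & size r = #|inversions w|.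
Proof.
elim/perm_ascent_ind: w => [|w i asc [r Er sr]].
  exists [::]; first by rewrite /word_perm big_nil.
  have := card_inversions_word [::]; rewrite /word_perm big_nil leqn0.
  by move/eqP->.
exists (i :: r); first by rewrite /word_perm big_cons -/(word_perm r) Er.
by rewrite card_inversions_ascent // -sr.
Qed.


(** Replaces minimality over all words by a count: each letter adds at most one inversion, and some
    word attains this bound. *)
Lemma reduced_wordE w r :
  reduced_word_of w r = (word_perm r == w) && (size r == #|inversions w|).
Proof.
apply/reduced_word_ofP/andP => [[Er min_r]|[/eqP Er /eqP sr]]; last first.
  by split=> // s Es; rewrite sr -Es card_inversions_word.
have [s Es ss] := word_of_inversions w.
split; first exact/eqP.
by rewrite eqn_leq -{1}ss min_r // -Er card_inversions_word.
Qed.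

End Length.

(** * Matsumoto's theorem and the positive lift *)

Section PositiveLift.

Variable n : nat.
Implicit Types (w : 'S_n) (i j : 'I_n.-1) (r s : seq 'I_n.-1).

Lemma artin_braid i j : j = i.+1 :> nat ->
  artin i * artin j * artin i = artin j * artin i * artin j.
Proof.
move=> ij.
have: to_braid (pos_word [:: i; j; i]) = to_braid (pos_word [:: j; i; j]).
  exact/eqP/to_braidP/BraidBraid.
by rewrite !to_braid_pos !big_cons !big_nil !mulg1 !mulgA.
Qed.

Lemma artin_comm i j : (i.+1 < j) || (j.+1 < i) ->
  commute (artin i) (artin j).
Proof.
wlog ij : i j / i.+1 < j => [IH|_].
  by case/orP=> ij; [|apply: commute_sym]; apply: IH; rewrite ?ij.
have: to_braid (pos_word [:: i; j]) = to_braid (pos_word [:: j; i]).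
  exact/eqP/to_braidP/BraidComm.
by rewrite !to_braid_pos !big_cons !big_nil !mulg1.
Qed.

Lemma word_perm_cons i r : word_perm (i :: r) = simple_refl i \oS word_perm r.
Proof. by rewrite /word_perm big_cons. Qed.

Lemma reduced_cons i w r : ascent w i ->
  reduced_word_of w r -> reduced_word_of (simple_refl i \oS w) (i :: r).
Proof.
rewrite !reduced_wordE => asc /andP[/eqP Er /eqP sr].
by rewrite word_perm_cons Er card_inversions_ascent //= sr !eqxx.
Qed.

(** Were i not an ascent of the product of the tail, that product would have more inversions than
    letters. *)
Lemma reduced_consI i w r : reduced_word_of w (i :: r) ->
  ascent (simple_refl i \oS w) i /\ reduced_word_of (simple_refl i \oS w) r.
Proof.
rewrite !reduced_wordE word_perm_cons => /andP[/eqP <- /= /eqP sr].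
have le_r := card_inversions_word r.
have asc : ascent (word_perm r) i.
  apply: contraT; rewrite -ascent_simple_refl => /card_inversions_ascent.
  rewrite simple_reflKl -sr => inv_r; move: le_r; rewrite inv_r; lia.
rewrite simple_reflKl asc eqxx; move: sr; rewrite card_inversions_ascent //.
by case=> ->; rewrite eqxx.
Qed.

Lemma ascentN_simple_refl w i j : (i.+1 < j) || (j.+1 < i) ->
  ascent (simple_refl i \oS w) j = ascent w j.
Proof.
move=> ij; rewrite /ascent !simple_reflVE.
by congr (w^-1 _ < w^-1 _); apply/val_inj; rewrite /= simple_reflE /=;
  do 2?case: ifP; lia.
Qed.

Lemma simple_refl_comm i j : (i.+1 < j) || (j.+1 < i) ->
  simple_refl i \oS simple_refl j = simple_refl j \oS simple_refl i.
Proof.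
by move=> ij; rewrite -!braid_perm_artin -!braid_permM artin_comm.
Qed.

Lemma simple_refl_braid i j : j = i.+1 :> nat ->
  simple_refl i \oS simple_refl j \oS simple_refl i
    = simple_refl j \oS simple_refl i \oS simple_refl j.
Proof.
by move=> ij; rewrite -!braid_perm_artin -!braid_permM artin_braid.
Qed.

(** Induction on length. Words with distinct first letters i and j are compared through reduced
    words that start with the longest element of the subgroup generated by s_i and s_j: the tails
    agree by induction, the heads by one braid or commutation relation. *)
Lemma matsumoto w r s : reduced_word_of w r -> reduced_word_of w s ->
  \prod_(i <- r) artin i = \prod_(i <- s) artin i.
Proof.
have [m] := ubnP #|inversions w|; elim: m w r s => // m IHm w r s lt_m.
case: r s => [|i r] [|j s] // redr reds.
1,2: by move: redr reds; rewrite !reduced_wordE => /andP[_ /eqP<-] /andP[].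
wlog le_ij : i j r s redr reds / i <= j => [IH|].
  case: (leqP i j) => [|/ltnW] le_ij; first exact: IH.
  by apply/esym; apply: IH.
have [asci redr'] := reduced_consI redr.
have [ascj reds'] := reduced_consI reds.
have lt_i : #|inversions (simple_refl i \oS w)| < m.
  by have := card_inversions_ascent asci; rewrite simple_reflKl; lia.
have lt_j : #|inversions (simple_refl j \oS w)| < m.
  by have := card_inversions_ascent ascj; rewrite simple_reflKl; lia.
rewrite !big_cons.
have [ij|] := eqVneq i j.
  by rewrite ij in redr' *; congr (_ * _); apply: IHm redr' reds'.
rewrite -val_eqE /= => ne_ij.
have [lt_ij|] := ltnP i.+1 j.
  (* Distant letters: w = s_i s_j z = s_j s_i z, with lengths adding in both factorizations. *)
  set z := simple_refl j \oS (simple_refl i \oS w).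
  have ascz : ascent z j.
    rewrite /z ascent_simple_refl ascentN_simple_refl ?lt_ij //.
    by rewrite -ascent_simple_refl.
  have asczi : ascent z i.
    by rewrite /z ascentN_simple_refl // lt_ij orbT.
  have [q redq] := reduced_word_exists z.
  have Ei : simple_refl j \oS z = simple_refl i \oS w by rewrite simple_reflKl.
  have Ej : simple_refl i \oS z = simple_refl j \oS w.
    rewrite /z pcompA simple_refl_comm ?lt_ij // -pcompA.
    by rewrite simple_reflKl.
  have := reduced_cons ascz redq; rewrite Ei => redq1.
  have := reduced_cons asczi redq; rewrite Ej => redq2.
  rewrite (IHm _ _ _ lt_i redr' redq1) (IHm _ _ _ lt_j reds' redq2) !big_cons.
  by rewrite !mulgA artin_comm // lt_ij.
move=> le_ji; have {ne_ij le_ji le_ij} ij : j = i.+1 :> nat by lia.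
set si := simple_refl i in asci redr' lt_i *.
set sj := simple_refl j in ascj reds' lt_j *.
have lohi : lo j = hi i by apply/val_inj.
have sjlo : sj (lo i) = lo i.
  by apply/val_inj; rewrite /= simple_reflE /=; do 2?case: ifP; lia.
have sihi : si (hi j) = hi j.
  by apply/val_inj; rewrite /= simple_reflE /=; do 2?case: ifP; lia.
have silo : si (lo i) = hi i := simple_refl_lo i.
have sihi' : si (hi i) = lo i := simple_refl_hi i.
have sjlo' : sj (hi i) = hi j by rewrite -lohi; exact: simple_refl_lo.
have sjhi : sj (hi j) = hi i by rewrite -lohi; exact: simple_refl_hi.
(* Adjacent letters: [d1] and [d2] say that the values [hi j], [hi i], [lo i] occur in this order in
   [w]. In [z] they occur in increasing order, so both i and j are ascents of [z]. *)
move: (asci) (ascj); rewrite /ascent !simple_reflVE -/si -/sj lohi.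
rewrite silo sihi' sjlo' sjhi => d1 d2.
pose z := si \oS (sj \oS (si \oS w)).
have Ez : z = sj \oS (si \oS (sj \oS w)).
  by rewrite /z !pcompA simple_refl_braid.
have asc1 : ascent z i.
  by rewrite /ascent !simple_reflVE -/si -/sj silo sihi' sjlo sjlo' silo sihi.
have asc2 : ascent (si \oS z) j.
  rewrite /z simple_reflKl /ascent !simple_reflVE -/si -/sj lohi.
  by rewrite sjlo' sjhi sihi sihi'; apply: ltn_trans d1.
have asc3 : ascent z j.
  rewrite Ez /ascent !simple_reflVE -/si -/sj lohi.
  by rewrite sjlo' sjhi sihi sihi' sjhi sjlo.
have asc4 : ascent (sj \oS z) i.
  rewrite Ez simple_reflKl /ascent !simple_reflVE -/si -/sj.
  by rewrite silo sihi' sjlo sjlo'; apply: ltn_trans d1.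
have [q redq] := reduced_word_exists z.
have := reduced_cons asc2 (reduced_cons asc1 redq).
rewrite [in X in reduced_word_of X _]/z !simple_reflKl => redq1.
have := reduced_cons asc4 (reduced_cons asc3 redq).
rewrite [in X in reduced_word_of X _]Ez !simple_reflKl => redq2.
rewrite (IHm _ _ _ lt_i redr' redq1) (IHm _ _ _ lt_j reds' redq2) !big_cons.
by rewrite !mulgA artin_braid.
Qed.

Lemma Blift_word w r : reduced_word_of w r -> Blift w = \prod_(i <- r) artin i.
Proof. exact/matsumoto/(xchooseP (reduced_word_exists w)). Qed.

Lemma word_perm_rev r : word_perm (rev r) = (word_perm r)^-1.
Proof.
elim: r => [|i r IHr]; first by rewrite /word_perm !big_nil invg1.
rewrite rev_cons -cats1 word_perm_cat IHr [word_perm (i :: r)]word_perm_cons.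
by rewrite /Defs.pcomp invMg /word_perm big_seq1 tpermV.
Qed.

Lemma reduced_rev w r : reduced_word_of w r -> reduced_word_of w^-1 (rev r).
Proof.
case/reduced_word_ofP=> Er min_r; apply/reduced_word_ofP.
rewrite word_perm_rev Er; split=> // s Es.
by rewrite size_rev -(size_rev s); apply: min_r; rewrite word_perm_rev Es invgK.
Qed.

Lemma BliftV w r : reduced_word_of w r ->
  Blift w^-1 = \prod_(i <- rev r) artin i.
Proof. by move/reduced_rev/Blift_word. Qed.

Lemma Blift1 : Blift (1 : 'S_n) = 1.
Proof.
rewrite (@Blift_word _ [::]) ?big_nil //; apply/reduced_word_ofP.
by split=> //; rewrite /word_perm big_nil.
Qed.

Lemma Blift_ascentl w i : ascent w i ->
  Blift (simple_refl i \oS w) = artin i * Blift w.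
Proof.
have [r redr] := reduced_word_exists w => asc.
by rewrite (Blift_word redr) (Blift_word (reduced_cons asc redr)) big_cons.
Qed.

(** Mirror image of [Blift_ascentl], obtained by reversing a reduced word of [w^-1]. *)
Lemma Blift_ascentr w i : w (lo i) < w (hi i) ->
  Blift (w \oS simple_refl i) = Blift w * artin i.
Proof.
have [r redr] := reduced_word_exists w^-1; rewrite -{1 2}[w]invgK => asc.
rewrite -[w]invgK (BliftV redr).
have := BliftV (reduced_cons asc redr); rewrite /Defs.pcomp invMg tpermV.
by rewrite rev_cons big_rcons /= => ->.
Qed.

End PositiveLift.

(** * Jucys-Murphy braids and multiplication by the Coxeter element *)

Section JucysMurphy.

Variable n : nat.
Implicit Types (w : 'S_n) (i j k : nat).

(* Equal to 1 when k is not the index of an Artin generator.                  *)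
Definition sigma k : braid n := if insub k is Some i then artin i else 1.

Lemma sigmaE (i : 'I_n.-1) : sigma i = artin i.
Proof. by rewrite /sigma valK. Qed.

Lemma sigma_braid k : k.+2 < n ->
  sigma k * sigma k.+1 * sigma k = sigma k.+1 * sigma k * sigma k.+1.
Proof.
move=> lt_k; have lt1 : k < n.-1 by lia.
have lt2 : k.+1 < n.-1 by lia.
by rewrite (sigmaE (Ordinal lt1)) (sigmaE (Ordinal lt2)) artin_braid.
Qed.

Lemma sigma_comm i j : (i.+1 < j) || (j.+1 < i) ->
  commute (sigma i) (sigma j).
Proof.
rewrite /sigma; case: insubP => [a _ <-|_ _]; last exact/commute_sym/commute1.
by case: insubP => [b _ <-|_ _]; [exact: artin_comm | exact: commute1].
Qed.

(** A positive word for [vperm n k]; [sigma_asc] is one for its inverse. Generators are counted from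
    0. *)
Fixpoint sigma_desc k : braid n :=
  if k is k'.+1 then sigma k' * sigma_desc k' else 1.

Fixpoint sigma_asc k : braid n :=
  if k is k'.+1 then sigma_asc k' * sigma k' else 1.

(** The pure braid in which strand k, counted from 0, winds once around all the strands before
    it. *)
Fixpoint jucys_murphy k : braid n :=
  if k is k'.+1 then sigma k' * jucys_murphy k' * sigma k' else 1.

Lemma jucys_murphyE k : jucys_murphy k = sigma_desc k * sigma_asc k.
Proof. by elim: k => [|k /= ->]; rewrite ?mulg1 // !mulgA. Qed.

Lemma jucys_murphy_comm_gt j k : k < j -> commute (sigma j) (jucys_murphy k).
Proof.
elim: k => [|k IHk] lt_kj /=; first exact: commute1.
have c : commute (sigma j) (sigma k) by apply: sigma_comm; rewrite lt_kj orbT.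
exact: commuteM (commuteM c (IHk (ltnW lt_kj))) c.
Qed.

(** The essential case is k = j + 2: the braid relation carries s_j through the outer generators as
    s_(j+1), which commutes with the core L_j. *)
Lemma jucys_murphy_comm_lt j k :
  j.+1 < k -> k < n -> commute (sigma j) (jucys_murphy k).
Proof.
elim: k => [|k IHk] //; rewrite ltnS leq_eqVlt.
case/orP=> [/eqP <- lt_j|lt_jk lt_k] /=.
  have b := sigma_braid lt_j; have c := jucys_murphy_comm_gt (ltnSn j).
  move: b c; move: (sigma j) (sigma _) (jucys_murphy j) => x y z b c.
  rewrite /commute !mulgA b -!mulgA; do 2!congr (_ * _).
  by rewrite mulgA c -mulgA; congr (_ * _); rewrite !mulgA b.
have c : commute (sigma j) (sigma k) by apply: sigma_comm; rewrite lt_jk.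
exact: commuteM (commuteM c (IHk lt_jk (ltnW lt_k))) c.
Qed.

Lemma jucys_murphy_comm j k : j < n -> k < n ->
  commute (jucys_murphy j) (jucys_murphy k).
Proof.
wlog lt_jk : j k / j < k => [IH lt_j lt_k|].
  by case: (ltngtP j k) => [jk|jk|->] //; [|apply: commute_sym]; exact: IH.
move=> _ lt_k; apply: commute_sym.
elim: j lt_jk => [|j IHj] lt_jk; first exact: commute1.
have c := commute_sym (jucys_murphy_comm_lt lt_jk lt_k).
exact: commuteM (commuteM c (IHj (ltnW lt_jk))) c.
Qed.

Lemma val_gens a b : b <= n.-1 ->
  map val (gens n a b) = index_iota a b.
Proof.
move=> le_b; transitivity [seq i <- iota 0 n.-1 | a <= i < b].
  by rewrite -val_enum_ord filter_map.
apply: (sorted_eq ltn_trans) => [x y|||].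
- by rewrite /= => /andP[/ltn_trans h /h]; rewrite ltnn.
- by apply: sorted_filter (iota_ltn_sorted _ _) => x y z; exact: ltn_trans.
- exact: iota_ltn_sorted.
apply: uniq_perm; rewrite ?filter_uniq ?iota_uniq // => x.
by rewrite mem_filter mem_index_iota mem_iota; lia.
Qed.

Lemma prod_gens a b : b <= n.-1 ->
  \prod_(i <- gens n a b) artin i = \prod_(a <= k < b) sigma k.
Proof.
move=> le_b; rewrite -(val_gens a le_b) big_map.
by apply: eq_bigr => i _; rewrite sigmaE.
Qed.

Lemma vperm0 : vperm n 0 = 1.
Proof.
rewrite /vperm (_ : gens n 0 0 = [::]) ?/word_perm ?big_nil //.
by apply: (inj_map val_inj); rewrite val_gens.
Qed.

Lemma vpermS (i : 'I_n.-1) : vperm n i.+1 = simple_refl i \oS vperm n i.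
Proof.
rewrite /vperm (_ : gens n 0 i.+1 = rcons (gens n 0 i) i).
  by rewrite rev_rcons word_perm_cons.
apply: (inj_map val_inj).
rewrite map_rcons !val_gens // ?(ltnW (ltn_ord i)) //.
by rewrite /index_iota !subn0 -addn1 iotaD cats1.
Qed.

Lemma coxVE : cox n = (vperm n n.-1)^-1.
Proof.
rewrite /vperm word_perm_rev invgK /cox; congr word_perm.
apply: (inj_map val_inj).
by rewrite val_gens // val_enum_ord /index_iota subn0.
Qed.

(** Composing with v_k brings the value at position k to the front. It exceeds all values before it,
    so each of the k adjacent exchanges creates an inversion. *)
Lemma Blift_vperm w k : k < n ->
  (forall i j : 'I_n, i < k -> j = k :> nat -> w i < w j) ->
  Blift (w \oS vperm n k) = Blift w * sigma_desc k.
Proof.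
elim: k w => [|k IHk] w lt_k ltw; first by rewrite vperm0 pcompg1 mulg1.
have lt_k' : k < n.-1 by lia.
have := vpermS (Ordinal lt_k'); rewrite /= => ->; set s := simple_refl _.
rewrite pcompA IHk ?(ltnW lt_k) //= => [|i j lt_i Ej].
  rewrite Blift_ascentr; last by apply: ltw => /=.
  by rewrite mulgA -(sigmaE (Ordinal lt_k')).
rewrite !pcompE; have -> : j = lo (Ordinal lt_k') by apply/val_inj.
rewrite simple_refl_lo; have -> : s i = i.
  by apply/val_inj; rewrite /= simple_reflE /=; do 2?case: ifP; lia.
by apply: ltw => //; apply: ltnW.
Qed.

(** The same on values: value k, standing right of all smaller ones, is lowered to 0 and gains k
    inversions. *)
Lemma Blift_vpermV w k : k < n ->
  (forall i j : 'I_n, i < k -> j = k :> nat -> w^-1 i < w^-1 j) ->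
  Blift ((vperm n k)^-1 \oS w) = sigma_asc k * Blift w.
Proof.
elim: k w => [|k IHk] w lt_k ltw.
  by rewrite vperm0 invg1 pcomp1g mul1g.
have lt_k' : k < n.-1 by lia.
have := vpermS (Ordinal lt_k'); rewrite /= => ->; set s := simple_refl _.
have -> : (s \oS vperm n k)^-1 = (vperm n k)^-1 \oS s.
  by rewrite /Defs.pcomp invMg tpermV.
rewrite -(pcompA (vperm n k)^-1 s w).
rewrite (IHk (s \oS w)); last 2 first.
- exact: ltnW.
- move=> i j lt_i Ej; rewrite !simple_reflVE.
  have -> : j = lo (Ordinal lt_k') by apply/val_inj.
  rewrite simple_refl_lo; have -> : s i = i.
    by apply/val_inj; rewrite /= simple_reflE /=; do 2?case: ifP; lia.
  by apply: ltw => //; apply: ltnW.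
rewrite Blift_ascentl; last by apply: ltw => /=.
by rewrite mulgA -(sigmaE (Ordinal lt_k')).
Qed.

Lemma Blift_cox : 0 < n -> Blift (cox n) = sigma_asc n.-1.
Proof.
move=> n_gt0; rewrite coxVE -[_^-1]pcompg1 Blift_vpermV ?Blift1 ?mulg1 //.
  by lia.
by move=> i j lt_i Ej; rewrite invg1 !perm1 Ej.
Qed.

(* Moving the value n - 1 from the last position to the value 0 creates       *)
(* n - 1 inversions, so the factorization is length-additive.                 *)
Lemma Blift_coxM w : 0 < n ->
  (forall i : 'I_n, i = n.-1 :> nat -> w i = i) ->
  Blift (cox n \oS w) = Blift (cox n) * Blift w.
Proof.
move=> n_gt0 w_last; rewrite Blift_cox // coxVE Blift_vpermV //; first by lia.
move=> i j lt_i Ej; have wj : w^-1 j = j by rewrite -{1}(w_last j Ej) permK.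
rewrite wj Ej ltn_neqAle; apply/andP; split; last first.
  by have := ltn_ord (w^-1 i); lia.
rewrite -Ej val_eqE -{1}wj (inj_eq perm_inj) -val_eqE /= Ej; lia.
Qed.

(** Induction along an ascent i of [w]. If w(0) = i, the new s_i completes L_i to s_i L_i s_i =
    L_(i+1); otherwise s_i commutes with the Jucys-Murphy factor and is absorbed by the lift of w
    c. *)
Lemma Blift_mul_cox w (z : 'I_n) : z = 0%N :> nat ->
  Blift w * Blift (cox n) = jucys_murphy (w z) * Blift (w \oS cox n).
Proof.
move=> Ez; move: (cox n) (@coxE n) => cn cnE.
elim/perm_ascent_ind: w => [|w i asc IHw].
  by rewrite Blift1 perm1 Ez pcomp1g.
rewrite (Blift_ascentl asc) -mulgA IHw pcompE mulgA.
rewrite -(pcompA (simple_refl i) w (cn)).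
(* Right multiplication by c moves the first entry of the one-line notation to the end. *)
have posV (a : 'I_n) : (w \oS cn)^-1 a
    = (if w^-1 a == 0 :> nat then n.-1 else (w^-1 a).-1) :> nat.
  rewrite /Defs.pcomp invMg permM; set b := w^-1 a.
  have := cnE ((cn)^-1 b); rewrite permKV.
  move: (ltn_ord ((cn)^-1 b)) (ltn_ord b); set c := nat_of_ord _.
  move=> lt_c lt_b Eb; have [lt_c1|ge_c1] := ltnP c.+1 n.
    by rewrite (modn_small lt_c1) in Eb; rewrite Eb.
  have Ec : c.+1 = n by lia.
  by rewrite Ec modnn in Eb; rewrite Eb eqxx; lia.
have ne_hi : w z != hi i.
  by apply/eqP=> Ehi; move: asc; rewrite /ascent -Ehi permK Ez.
have [Elo|ne_lo] := eqVneq (w z) (lo i).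
  (* The value i has moved to the last place, so i is a descent of w c, and s_i splits off its
     lift. *)
  have asc' : ascent (simple_refl i \oS (w \oS cn)) i.
    rewrite ascent_simple_refl /ascent !posV -Elo permK Ez /= -leqNgt.
    by have := ltn_ord (w^-1 (hi i)); case: ifP; lia.
  have := Blift_ascentl asc'; rewrite simple_reflKl => ->.
  rewrite Elo simple_refl_lo /= -(sigmaE i) !mulgA; exact: erefl.
rewrite Blift_ascentl; last first.
  rewrite /ascent !posV.
  have nz a : w z != a -> (w^-1 a == 0 :> nat) = false.
    move=> ne; apply/negP=> /eqP Ea; case/eqP: ne.
    have -> : z = w^-1 a by apply/val_inj; rewrite /= Ez.
    exact: permKV.
  have := asc; rewrite /ascent !(nz _ ne_lo, nz _ ne_hi).
  by have := nz _ ne_lo; lia.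
rewrite mulgA; congr (_ * _); rewrite -(sigmaE i).
have -> : simple_refl i (w z) = w z.
  by apply: tpermD; rewrite eq_sym.
move: ne_lo ne_hi; rewrite -!val_eqE /= => ne_lo ne_hi.
have [lt|ge] := ltnP i (w z).
  by apply: jucys_murphy_comm_lt (ltn_ord _); lia.
by apply: jucys_murphy_comm_gt; lia.
Qed.

End JucysMurphy.

(** Serves to reorder Jucys-Murphy factors inside the nonabelian braid group. *)
Lemma prod_perm_commute (T : eqType) (G : groupType) (F : T -> G)
    (s t : seq T) :
  {in s &, forall x y, commute (F x) (F y)} -> perm_eq s t ->
  \prod_(x <- s) F x = \prod_(x <- t) F x.
Proof.
elim: s t => [|a s IHs] t cF eq_st.
  by move: eq_st; rewrite perm_sym => /perm_nilP ->.
have ta : a \in t by rewrite -(perm_mem eq_st) mem_head.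
case/splitPr: ta eq_st => t1 t2 eq_st.
have eq_s : perm_eq s (t1 ++ t2).
  by rewrite -(perm_cons a) (perm_trans eq_st) // (perm_catCA t1 [:: a] t2).
have cF' : {in s &, forall x y, commute (F x) (F y)}.
  by move=> x y sx sy; apply: cF; rewrite inE ?sx ?sy orbT.
rewrite big_cons (IHs _ cF' eq_s) !big_cat big_cons /= !mulgA.
congr (_ * _); rewrite big_seq; apply: commute_prod => x t1x.
apply: cF; first exact: mem_head.
by rewrite (perm_mem eq_st) mem_cat t1x.
Qed.

(** * Jucys-Murphy braids as products of squared dual lifts *)

Section DualLifts.

Variable n : nat.
Implicit Types i j k : nat.

Lemma dual_liftE (i j : 'I_n) : dual_lift i j =
  \prod_(i <= k < j) sigma n k * (\prod_(i <= k < j.-1) sigma n k)^-1.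
Proof. by rewrite /dual_lift !prod_gens //; have := ltn_ord j; lia. Qed.

(** In L_(k+1) = s_k^2 (s_k^-1 L_k s_k), generators counted from 0, the square is the new factor,
    and conjugation by s_k turns the dual lift of (i k) into that of (i k+1). *)
Lemma jucys_murphy_dual k : k < n ->
  jucys_murphy n k = \prod_(i <- rev (iota 0 k))
    (\prod_(i <= j < k) sigma n j * (\prod_(i <= j < k.-1) sigma n j)^-1) ^+ 2.
Proof.
elim: k => [|k IHk] lt_k; first by rewrite big_nil.
rewrite -addn1 iotaD rev_cat big_cat /= addn1 /= big_seq1.
rewrite big_nat1 big_geq // invg1 mulg1.
have -> : sigma n k * jucys_murphy n k * sigma n k
    = sigma n k ^+ 2 * jucys_murphy n k ^ sigma n k.
  by rewrite conjgE expgS expg1 !mulgA mulgK.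
congr (_ * _); rewrite IHk ?(ltnW lt_k) //.
rewrite conjg_prod big_seq [RHS]big_seq; apply: eq_bigr => i.
rewrite mem_rev mem_iota add0n /= => lt_ik.
rewrite conjXg; congr (_ ^+ 2); case: k => // k in lt_k lt_ik IHk *.
rewrite !big_nat_recr //= => {IHk}; last exact: ltnW.
set A := \prod_(_ <= _ < _) _.
have cA : commute (sigma n k.+1) A.
  rewrite /A big_nat; apply: commute_prod => j lt_j.
  by apply: sigma_comm; lia.
have b := sigma_braid lt_k; move: cA b.
move: (sigma n k) (sigma n k.+1) => x y cA b.
have -> : (A * x * A^-1) ^ y = A * (x ^ y) * A^-1.
  have cA' : A ^ y = A by apply/conjg_fixP/commgP/commute_sym.
  by rewrite !conjMg conjVg cA'.
(* The braid relation, solved for the conjugate of the middle generator. *)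
have -> : x ^ y = x * y * x^-1.
  by rewrite conjgE; apply: (mulgI y); rewrite mulKVg !mulgA -b mulgK.
by rewrite invMg !mulgA.
Qed.

End DualLifts.

(** * Lifts of increasing products of the v_k *)

Section VProducts.

Variable n : nat.
Implicit Types (k : nat) (ks : seq nat).

Lemma vperm_gt k (a : 'I_n) : k < n -> k < a -> vperm n k a = a.
Proof.
elim: k => [|k IHk] lt_k lt_ka; first by rewrite vperm0 perm1.
have lt_k' : k < n.-1 by lia.
have := vpermS (Ordinal lt_k'); rewrite /= => ->.
rewrite pcompE IHk ?(ltnW lt_k) ?(ltnW lt_ka) //.
by apply/val_inj; rewrite /= simple_reflE /=; do 2?case: ifP; lia.
Qed.

Definition vprod ks : 'S_n := \big[@Defs.pcomp n/1]_(k <- ks) vperm n k.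

Lemma vprod_gt ks (a : 'I_n) :
  all (fun k => k < a) ks -> vprod ks a = a.
Proof.
elim: ks => [_|k ks IHks /andP[lt_k lt_ks]].
  by rewrite /vprod big_nil perm1.
rewrite /vprod big_cons pcompE IHks // vperm_gt //.
exact: ltn_trans (ltn_ord a).
Qed.

Lemma jucys_murphy_comm_desc j k : j < k -> k < n ->
  commute (jucys_murphy n k) (sigma_desc n j).
Proof.
elim: j => [|j IHj] lt_jk lt_k /=; first exact: commute1.
apply: commuteM (IHj (ltnW lt_jk) lt_k).
exact/commute_sym/jucys_murphy_comm_lt.
Qed.

(** The product y of the earlier factors fixes every index from k on, so lengths add when v_k is
    appended. The new middle factor L_k then passes to the left of B(y), a product of
    [sigma_desc n j] with j < k by the first conjunct. *)
Lemma Blift_vprod ks : pairwise ltn ks -> all (fun k => k < n) ks ->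
  Blift (vprod ks) = \prod_(k <- ks) sigma_desc n k /\
  Blift (vprod ks) * Blift (vprod ks)^-1
    = \prod_(k <- rev ks) jucys_murphy n k.
Proof.
elim/last_ind: ks => [|ks k IHks].
  by rewrite /vprod !big_nil Blift1 invg1 Blift1 mulg1.
rewrite pairwise_rcons all_rcons => /andP[lt_ks_k lt_ks] /andP[lt_k ks_n].
have [IH1 IH2] := IHks lt_ks ks_n.
have -> : vprod (rcons ks k) = vprod ks \oS vperm n k.
  by rewrite /vprod big_rcons.
have fix_y (a : 'I_n) : k <= a -> vprod ks a = a.
  move=> le_ka; apply: vprod_gt; apply: sub_all lt_ks_k => j /= lt_j.
  exact: leq_trans le_ka.
have lt_y (i j : 'I_n) : i < k -> j = k :> nat -> vprod ks i < vprod ks j.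
  move=> lt_i Ej; rewrite (fix_y j) ?Ej // ltnNge; apply/negP=> le_k.
  by have /perm_inj Ei := fix_y _ le_k; move: le_k; rewrite Ei leqNgt lt_i.
have E1 := Blift_vperm lt_k lt_y.
have E2 : Blift (vprod ks \oS vperm n k)^-1
    = sigma_asc n k * Blift (vprod ks)^-1.
  rewrite -(Blift_vpermV lt_k) ?invgK //.
  by rewrite /Defs.pcomp invMg.
split; first by rewrite E1 IH1 big_rcons.
rewrite E1 E2 rev_rcons big_cons -IH2 !mulgA; congr (_ * _).
rewrite -mulgA -jucys_murphyE; apply: commute_sym.
rewrite IH1 big_seq; apply: commute_prod => j ks_j.
by apply: jucys_murphy_comm_desc lt_k; move/allP: lt_ks_k; apply.
Qed.

End VProducts.

(** * Powers of c, arithmetic of the k_i, and the conjugator *)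

Lemma cox_expE n m (a : 'I_n) : (cox n ^+ m) a = (a + m) %% n :> nat.
Proof.
elim: m => [|m IHm]; first by rewrite perm1 addn0 modn_small.
by rewrite expgSr permM coxE IHm -addn1 modnDml addn1 addnS.
Qed.

Lemma Blift_mul_cox_exp n (w : 'S_n) (z : 'I_n) m : z = 0%N :> nat ->
  Blift w * Blift (cox n) ^+ m
  = \prod_(0 <= i < m) jucys_murphy n (w ((cox n ^+ i) z))
    * Blift (w \oS cox n ^+ m).
Proof.
move=> Ez; elim: m => [|m IHm].
  by rewrite big_geq // mul1g expg0 mulg1 pcompg1.
rewrite expgSr mulgA IHm big_nat_recr //= -mulgA (Blift_mul_cox _ Ez).
rewrite pcompE -(pcompA w) mulgA -[cox n ^+ m \oS cox n]/(cox n * cox n ^+ m).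
by rewrite -expgS.
Qed.

Lemma jucys_murphy_Pdual n (ks : seq nat) : all (fun k => k < n) ks ->
  exists ts : seq ('I_n * 'I_n),
    [/\ all (fun t : 'I_n * 'I_n => t.1 < t.2) ts,
        size ts = sumn ks
      & \prod_(k <- ks) jucys_murphy n k = \prod_(t <- ts) Pdual t.1 t.2].
Proof.
elim: ks => [_|k ks IHks /= /andP[lt_k /IHks[ts [ts_lt sz_ts Ets]]]].
  by exists [::]; rewrite !big_nil.
pose o := Ordinal lt_k.
(* The default [o] of [insubd] never occurs, since i < k < n. *)
exists ([seq (insubd o i, o) | i <- rev (iota 0 k)] ++ ts); split.
- rewrite all_cat ts_lt andbT all_map; apply/allP=> i.
  rewrite mem_rev mem_iota /= => lt_ik; rewrite val_insubd.
  by case: ifP => //; lia.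
- by rewrite size_cat size_map size_rev size_iota sz_ts.
rewrite big_cons big_cat big_map -Ets /=; congr (_ * _).
rewrite (jucys_murphy_dual lt_k) big_seq [RHS]big_seq; apply: eq_bigr => i.
rewrite mem_rev mem_iota /= => lt_ik.
rewrite /Pdual dual_liftE val_insubd ifT //.
exact: (ltn_trans lt_ik lt_k).
Qed.

(** Successive multiples of n/p differ by more than 1. *)
Lemma ltn_div_mul n p i j : 0 < p < n -> i < j -> (i * n) %/ p < (j * n) %/ p.
Proof.
case/andP=> p_gt0 lt_pn lt_ij; rewrite leq_divRL //.
by have := leq_trunc_div (i * n) p; nia.
Qed.

Lemma div_mul_lt n p i : 0 < n -> i < p -> (i * n) %/ p < n.
Proof. by move=> n_gt0 lt_ip; rewrite ltn_divLR; nia. Qed.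

(* The terms of indices i and p - i add up to n - 1. *)
Lemma sum_div_mul n p : 0 < p -> coprime p n ->
  ((\sum_(1 <= i < p) (i * n) %/ p) * 2 = n.-1 * p.-1)%N.
Proof.
move=> p_gt0 co_pn; rewrite muln2 -addnn {2}big_nat_rev -big_split /=.
rewrite big_nat (eq_bigr (fun=> n.-1)) => [|i /andP[i_gt0 lt_ip]].
  by rewrite -big_nat sum_nat_const_nat mulnC subn1.
have Ei := divn_eq (i * n) p; have lt_r := ltn_pmod (i * n) p_gt0.
(* By coprimality p would otherwise divide i, although 0 < i < p. *)
have r_gt0 : 0 < (i * n) %% p.
  rewrite lt0n; apply/negP; rewrite -/(dvdn p _) Gauss_dvdl //.
  by move/(dvdn_leq i_gt0); lia.
have n_gt0 : 0 < n by move: r_gt0; case: (n); rewrite // muln0 mod0n.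
have lt_q := div_mul_lt n_gt0 lt_ip.
(* With i n = q p + r, this is the division of (p - i) n by p: quotient n - q - 1, remainder p -
   r. *)
have -> : ((1 + p - i.+1) * n
    = (n - ((i * n) %/ p).+1) * p + (p - (i * n) %% p))%N.
  move: lt_r lt_q Ei; move: ((i * n) %/ p) ((i * n) %% p) => q r.
  move=> lt_r lt_q Ei; move: Ei lt_r.
  have [d ->] : exists d, n = q.+1 + d by exists (n - q.+1)%N; lia.
  have [e Ep] : exists e, p = i + e by exists (p - i)%N; lia.
  by rewrite Ep add1n subSS !addKn; nia.
rewrite divnMDl // [(p - _) %/ p]divn_small ?addn0; last by lia.
by lia.
Qed.

Lemma modnS_inj n a b : a < n -> b < n -> a.+1 = b.+1 %[mod n] -> a = b.
Proof.
move=> lt_a lt_b /eqP; rewrite -(addn1 a) -(addn1 b) eqn_modDr => /eqP.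
by rewrite !modn_small.
Qed.

Theorem theorem7p11 (n p p' : nat)
    (hp : (1 <= p <= n.-1)%N)
    (hpn : coprime p n)
    (hp' : (1 <= p' < n)%N)
    (hpp' : (p * p' = 1 %[mod n])%N)
    (g : 'S_n)
    (hg : forall i : 'I_n, ((g i).+1 = i.+1 * p' %[mod n])%N) :
  (Blift g * Blift (cox n) ^+ p * (Blift g)^-1 * (Blift (cox n))^-1
     = Blift (xperm n p) * Blift (xperm n p)^-1)%g /\
  realizable_positive_dual_conjugator p (Blift g).
Proof.
have n_gt0 : 0 < n by lia.
have lt_pn : 0 < p < n by lia.
have p_gt0 : 0 < p by lia.
pose z := Ordinal n_gt0.
(* Counting from 1, (i + p) p' is congruent to i p' + 1. *)
have conj_g : cox n \oS g = g \oS cox n ^+ p.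
  apply/permP=> i; rewrite !pcompE; apply/val_inj.
  apply: (@modnS_inj n); rewrite ?ltn_ord //= coxE.
  rewrite -[((g i).+1 %% n).+1]addn1 hg modnDml [RHS]hg cox_expE.
  rewrite -[((i + p) %% n).+1]addn1 -[RHS]modnMml modnDml modnMml.
  by rewrite addnAC mulnDl -[RHS]modnDmr hpp' modnDmr !addn1.
have g_last (i : 'I_n) : i = n.-1 :> nat -> g i = i.
  move=> Ei; apply/val_inj/(@modnS_inj n); rewrite ?ltn_ord // hg Ei.
  rewrite (prednK n_gt0) modnMr.
  by rewrite /= Ei prednK ?modnn.
pose ks := [seq (i * n) %/ p | i <- index_iota 1 p].
(* The p factors from D^p match k_0, ..., k_(p-1); the extra k_0 = 0 contributes L_0 = 1. *)
pose ks0 := [seq (i * n) %/ p | i <- iota 0 p].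
have lt_ks0 : all (fun k => k < n) ks0.
  rewrite all_map; apply/allP=> i; rewrite mem_iota => /= lt_ip.
  exact: div_mul_lt.
have Eks0 : ks0 = 0%N :: ks.
  rewrite /ks0 /ks /index_iota; case: (p) p_gt0 => // q _.
  by rewrite subn1 /= div0n.
have pw_ks0 : pairwise ltn ks0.
  rewrite pairwise_map; apply: sub_pairwise (_ : pairwise ltn _).
    by move=> i j; apply: ltn_div_mul.
  by rewrite -sorted_pairwise ?iota_ltn_sorted //; exact: ltn_trans.
have [pw_ks lt_ks] : pairwise ltn ks /\ all (fun k => k < n) ks.
  by move: pw_ks0 lt_ks0; rewrite Eks0 /= => /andP[_ ->] /andP[].
have perm_g : perm_eq [seq val (g ((cox n ^+ i) z)) | i <- iota 0 p] ks0.
  have uniq_ks0 : uniq ks0.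
    by apply: pairwise_uniq pw_ks0; exact: ltnn.
  set s := map _ _.
  have sub_s : {subset ks0 <= s}.
    move=> k /mapP[i]; rewrite mem_iota /= => lt_ip -> {k}.
    have lt_r := ltn_pmod (i * n) p_gt0.
    (* Counting from 1, position p - (i n mod p) is congruent to (k_i + 1) p modulo n, so g sends it
       to k_i + 1. Inclusion suffices, as [ks0] has no repetition and both lists have p entries. *)
    apply/mapP; exists (p - (i * n) %% p).-1; first by rewrite mem_iota; lia.
    apply: (@modnS_inj n); rewrite ?ltn_ord ?div_mul_lt // hg cox_expE /=.
    rewrite add0n [_.-1 %% n]modn_small; last by lia.
    rewrite prednK; last by lia.
    have E : (i * n + (p - (i * n) %% p) = ((i * n) %/ p).+1 * p)%N.
      by rewrite {1}(divn_eq (i * n) p) mulSn; lia.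
    rewrite -[RHS](modnMDl (i * p')) [(i * p' * n)%N]mulnAC -mulnDl E.
    by rewrite -mulnA -modnMmr hpp' modnMmr muln1.
  have le_s : size s <= size ks0 by rewrite !size_map.
  have [_ eq_s] := uniq_min_size uniq_ks0 sub_s le_s.
  rewrite perm_sym; apply: uniq_perm eq_s => //.
  exact: leq_size_uniq sub_s le_s.
have Ex : xperm n p = vprod n ks by rewrite /xperm /vprod big_map.
have [_ prod_x] := Blift_vprod pw_ks lt_ks.
have conjE : conj_braid p (Blift g) = \prod_(k <- rev ks) jucys_murphy n k.
  rewrite /conj_braid (@Blift_mul_cox_exp _ _ z) // -conj_g.
  (* The trailing lift of c g splits as D B(g), which cancels against the two inverses. *)
  rewrite (Blift_coxM n_gt0 g_last) mulgA !mulgK.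
  rewrite /index_iota subn0 -(big_map _ xpredT (jucys_murphy n)).
  have cJ s : all (fun k => k < n) s ->
      {in s &, forall j k, commute (jucys_murphy n j) (jucys_murphy n k)}.
    by move=> /allP lt_s j k /lt_s lt_j /lt_s lt_k; apply: jucys_murphy_comm.
  rewrite -(prod_perm_commute (cJ _ lt_ks0)) 1?perm_sym //.
  rewrite Eks0 big_cons mul1g; apply: prod_perm_commute (cJ _ lt_ks) _.
  by rewrite perm_sym perm_rev.
have real_x : conj_braid p (Blift g) = Blift (xperm n p) * Blift (xperm n p)^-1.
  by rewrite conjE Ex -prod_x.
split; first exact: real_x.
split; last by exists (xperm n p).
split.
  by rewrite Blift_perm -conj_g /Defs.pcomp mulgA mulVg mul1g.
have [] := @jucys_murphy_Pdual n (rev ks); first by rewrite all_rev.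
move=> ts [lt_ts sz_ts prod_ts]; exists ts; split=> //.
  by rewrite sz_ts sumn_rev -sum_div_mul // sumnE big_map.
by rewrite conjE prod_ts.
Qed.
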